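(* Every graph $G$ with minimum degree $\delta(G)\ge 1$ has a TOI-coalition partition.
   Context: All graphs are finite, simple and undirected, with vertex set $V(G)$. A set $D\subseteq V(G)$ is a total outer-independent dominating set (TOIDS) of $G$ if every vertex of $G$ is adjacent to at least one vertex of $D$ and $V(G)\setminus D$ is an independent set of $G$. Two nonempty disjoint sets $X,Y\subseteq V(G)$ form a TOI-coalition (are TOI-coalition partners) if neither $X$ nor $Y$ is a TOIDS of $G$ but $X\cup Y$ is a TOIDS of $G$. A TOI-coalition partition of $G$ is a partition $\Psi=\{V_1,\dots,V_k\}$ of $V(G)$ into nonempty sets such that for every $V_i\in\Psi$ there exists $V_j\in\Psi$, $j\ne i$, such that $V_i$ and $V_j$ form a TOI-coalition. *)

(* Defs.v *)
From mathcomp Require Import all_boot.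

Set Implicit Arguments.
Unset Strict Implicit.
Unset Printing Implicit Defensive.

(* A finite simple graph is a symmetric irreflexive relation [e] on a finType. *)

Definition degree (T : finType) (e : rel T) (v : T) : nat :=
  #|[set u | e v u]|.

(* In a simple graph every degree is < #|T|, so the default value #|T| is
   neutral; a graph without vertices gets minimum degree 0. *)
Definition min_degree (T : finType) (e : rel T) : nat :=
  \big[minn/#|T|]_(v : T) degree e v.

Definition independent (T : finType) (e : rel T) (S : {set T}) : bool :=
  [forall u in S, forall v in S, ~~ e u v].

Definition total_dominating (T : finType) (e : rel T) (D : {set T}) : bool :=
  [forall v : T, exists u in D, e v u].

Definition toids (T : finType) (e : rel T) (D : {set T}) : bool :=
  total_dominating e D && independent e (~: D).

Definition toi_coalition (T : finType) (e : rel T) (X Y : {set T}) : bool :=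
  [&& X != set0, Y != set0, [disjoint X & Y],
      ~~ toids e X, ~~ toids e Y & toids e (X :|: Y)].

(* [partition] already requires the blocks to be nonempty. *)
Definition toi_coalition_partition (T : finType) (e : rel T)
    (Psi : {set {set T}}) : bool :=
  partition Psi [set: T] &&
  [forall X in Psi, exists Y in Psi, (Y != X) && toi_coalition e X Y].

(* Main.v *)
Require Import Defs.
From mathcomp Require Import all_boot.

(** Say that a set [X] splits the graph when neither [X] nor its complement is
    a TOIDS.  The whole vertex set is a TOIDS because no vertex is isolated, so
    a splitting set gives a coalition partition with the two blocks [X] and
    [~: X].

    A set fails to be a TOIDS as soon as it misses both ends of an edge, or
    misses the neighbourhood of a vertex ([toids_edge], [toids_neighbor]).
    Two consequences when nothing splits:
    - any two vertices [a], [b] have a common neighbour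
      ([nosplit_common_neighbor]), since otherwise the neighbourhood of [a]
      splits: it misses that of [b], and its complement misses that of [a];
    - any two edges share an end ([nosplit_edges_meet]), since otherwise the two
      ends of one of them split.
    The first point, for two adjacent vertices, gives a triangle [a b c].  A
    fourth vertex [d] would have a neighbour [x], and two vertices of the
    triangle other than [x] would form an edge disjoint from [d x], against the
    second point.  So the graph is the triangle.  There the partition into
    singletons works: a single vertex is not a TOIDS, as it does not dominate
    itself, and two vertices form the complement of a single vertex, which is a
    TOIDS because a single vertex does not split. *)

Set Implicit Arguments.
Unset Strict Implicit.
Unset Printing Implicit Defensive.

Lemma partition_setC (T : finType) (X : {set T}) :
  X != set0 -> ~: X != set0 -> partition [set X; ~: X] [set: T].
Proof.
move=> X0 XC0; apply/and3P; split.
- by rewrite /cover bigcup_setU !big_set1 setUCr.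
- apply/trivIsetP => A B /set2P[] -> /set2P[] -> //; rewrite ?eqxx // => _.
    by rewrite -setI_eq0 setICr.
  by rewrite -setI_eq0 setIC setICr.
- by rewrite !inE negb_or eq_sym X0 eq_sym XC0.
Qed.

Lemma partition_singletons (T : finType) :
  partition [set [set x] | x : T] [set: T].
Proof.
apply/and3P; split.
- apply/eqP/setP => x; rewrite inE; apply/bigcupP.
  by exists [set x]; rewrite ?set11 ?imset_f.
- apply/trivIsetP => _ _ /imsetP[x _ ->] /imsetP[y _ ->] xy.
  by rewrite disjoints1 inE; apply: contra xy => /eqP ->.
- by apply/imsetP => -[x _ /setP /(_ x)]; rewrite !inE eqxx.
Qed.

(** The least value is compared along the list of vertices, because [minn] has
    no neutral element in [nat] and [bigD1] does not apply to it. *)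
Lemma min_degree_le_degree (T : finType) (e : rel T) v : min_degree e <= degree e v.
Proof.
rewrite /min_degree; have : v \in index_enum T by rewrite mem_index_enum.
elim: (index_enum T) => // w s IHs; rewrite big_cons inE.
case/predU1P => [->|/IHs]; first exact: geq_minl.
exact: leq_trans (geq_minr _ _).
Qed.

Lemma min_degree_gt0_neighbor (T : finType) (e : rel T) :
  0 < min_degree e -> forall v, exists u, e v u.
Proof.
move=> e_deg v; have := leq_trans e_deg (min_degree_le_degree e v).
by case/card_gt0P => u; rewrite inE; exists u.
Qed.

(** Without vertices the default value of the minimum degree is [#|T| = 0]. *)
Lemma min_degree_gt0_inhabited (T : finType) (e : rel T) :
  0 < min_degree e -> exists v : T, true.
Proof.
have [v _|T0] := pickP (fun _ : T => true); first by exists v.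
by rewrite /min_degree big_pred0 // eq_card0.
Qed.

Lemma toids_setT (T : finType) (e : rel T) :
  (forall v, exists u, e v u) -> toids e [set: T].
Proof.
move=> nbr; apply/andP; split.
  by apply/forallP => v; have [u vu] := nbr v; apply/existsP; exists u; rewrite inE.
by apply/forall_inP => u; rewrite setCT inE.
Qed.

Lemma toids_neighbor (T : finType) (e : rel T) D v :
  toids e D -> exists2 u, u \in D & e v u.
Proof. by case/andP => /forallP /(_ v) /exists_inP. Qed.

Lemma toids_edge (T : finType) (e : rel T) D u v :
  toids e D -> e u v -> (u \in D) || (v \in D).
Proof.
case/andP => _ /forall_inP indD uv; apply: contraLR uv; rewrite negb_or.
by case/andP => uD vD; apply: (forall_inP (indD u _)); rewrite inE.
Qed.

Lemma irreflexive_neq (T : eqType) (e : rel T) u v :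
  irreflexive e -> e u v -> u != v.
Proof. by move=> e_irr; apply: contraTneq => ->; rewrite e_irr. Qed.

(** A lone vertex has no neighbour in its own singleton. *)
Lemma toids_set1F (T : finType) (e : rel T) x :
  irreflexive e -> ~~ toids e [set x].
Proof.
move=> e_irr; apply/negP => /(toids_neighbor x)[u /set1P ->].
by rewrite e_irr.
Qed.

(** The two blocks are partners because their union is the whole vertex set,
    which is a TOIDS in a graph without isolated vertices. *)
Lemma split_coalition_partition (T : finType) (e : rel T) (X : {set T}) :
  (forall v, exists u, e v u) -> ~~ toids e X -> ~~ toids e (~: X) ->
  toi_coalition_partition e [set X; ~: X].
Proof.
move=> /toids_setT VD nX nXC.
(* An empty block would make the other one the whole vertex set. *)
have XC0 : ~: X != set0.
  by apply: contraNneq nX => XC0; rewrite -[X]setCK XC0 setC0.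
have X0 : X != set0 by apply: contraNneq nXC => ->; rewrite setC0.
have dXC : [disjoint X & ~: X] by rewrite -setI_eq0 setICr.
have neqX : ~: X != X.
  apply: contraNneq X0 => XCE; move: dXC; rewrite XCE.
  by rewrite -setI_eq0 setIid.
apply/andP; split; first exact: partition_setC.
apply/forall_inP => _ /set2P[] ->; apply/exists_inP.
  exists (~: X); first exact: set22.
  by rewrite /toi_coalition neqX X0 XC0 dXC nX nXC setUCr.
exists X; first exact: set21.
by rewrite /toi_coalition eq_sym neqX X0 XC0 disjoint_sym dXC nX nXC setUC setUCr.
Qed.

Section NoSplit.

Variables (T : finType) (e : rel T).
Hypothesis e_irr : irreflexive e.
Hypothesis nosplit : forall X : {set T}, toids e X || toids e (~: X).

(** Take the neighbourhood of [a] as the candidate splitting set: its complement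
    cannot dominate [a], so it must itself dominate [b]. *)
Lemma nosplit_common_neighbor a b : exists2 c, e a c & e b c.
Proof.
case/orP: (nosplit [set c | e a c]) => [/(toids_neighbor b)|/(toids_neighbor a)].
  by case=> c; rewrite inE; exists c.
by case=> c; rewrite !inE => /negP.
Qed.

(** Take [[set u; v]] as the candidate splitting set: its complement leaves the
    edge [u v] uncovered, so it must itself cover [x y]. *)
Lemma nosplit_edges_meet u v x y :
  e u v -> e x y -> [|| x == u, x == v, y == u | y == v].
Proof.
move=> uv xy; case/orP: (nosplit [set u; v]) => [/toids_edge /(_ xy)|].
  by rewrite !inE -!orbA.
by move=> /toids_edge /(_ uv); rewrite !inE !eqxx orbT.
Qed.

(** An edge at a vertex [d] off the triangle would have to meet all three sides
    at its other end, and no vertex lies on all three sides. *)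
Lemma nosplit_triangle_spans a b c d :
  (forall v, exists u, e v u) -> e a b -> e a c -> e b c ->
  [|| d == a, d == b | d == c].
Proof.
move=> nbr ab ac bc; have [x dx] := nbr d.
have neq u v := @irreflexive_neq _ e u v e_irr.
have := nosplit_edges_meet bc dx; have := nosplit_edges_meet ac dx.
have := nosplit_edges_meet ab dx.
case: (d == a) (d == b) (d == c) => [] [] [] //=.
(* [d] is off the triangle, and its neighbour [x] is [a] or [b]. *)
case/orP => /eqP -> /=; rewrite ?eqxx ?orbT /=.
  by rewrite (negPf (neq _ _ ab)) (negPf (neq _ _ ac)).
by rewrite eq_sym (negPf (neq _ _ ab)) (negPf (neq _ _ bc)).
Qed.

(** The union of the two singletons is the complement of [[set z]], which is not
    a TOIDS; since [[set z]] does not split, that union is one. *)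
Lemma nosplit_coalition_set1 x y z :
  x != y -> x != z -> y != z ->
  (forall w, [|| w == x, w == y | w == z]) -> toi_coalition e [set x] [set y].
Proof.
move=> xy xz yz xyzT.
have pairE : [set x] :|: [set y] = ~: [set z].
  apply/setP => w; rewrite !inE; have := xyzT w.
  have [-> _|_] := eqVneq w z; last by rewrite orbF.
  by rewrite eq_sym (negPf xz) eq_sym (negPf yz).
have := nosplit [set z]; rewrite (negPf (toids_set1F _ e_irr)) /= => zCD.
by rewrite /toi_coalition -!card_gt0 !cards1 disjoints1 inE xy !toids_set1F ?pairE.
Qed.

Lemma nosplit_coalition_partition (a : T) :
  (forall v, exists u, e v u) ->
  toi_coalition_partition e [set [set x] | x : T].
Proof.
move=> nbr; have [b ab] := nbr a.
have [c ac bc] := nosplit_common_neighbor a b.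
have spans d := nosplit_triangle_spans d nbr ab ac bc.
have neq u v := @irreflexive_neq _ e u v e_irr.
have {ab ac bc neq} [ab ac bc] := And3 (neq _ _ ab) (neq _ _ ac) (neq _ _ bc).
rewrite /toi_coalition_partition partition_singletons /=.
have partner x y z : x != y -> x != z -> y != z ->
    (forall w, [|| w == x, w == y | w == z]) ->
    [exists Y in [set [set u] | u : T], (Y != [set x]) && toi_coalition e [set x] Y].
  move=> xy xz yz xyzT; apply/exists_inP; exists [set y]; first exact: imset_f.
  rewrite (nosplit_coalition_set1 xy xz yz xyzT) andbT.
  by rewrite eqEsubset sub1set inE eq_sym (negPf xy).
apply/forall_inP => _ /imsetP[x _ ->].
case/or3P: (spans x) => /eqP ->.
- exact: partner spans.
- apply: (partner b a c) => //; first by rewrite eq_sym.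
  by move=> w; rewrite orbCA spans.
- apply: (partner c a b) => //; rewrite 1?eq_sym //.
  by move=> w; rewrite orbC -orbA spans.
Qed.

End NoSplit.

Theorem proposition1 (T : finType) (e : rel T)
    (e_sym : symmetric e) (e_irr : irreflexive e)
    (e_deg : 1 <= min_degree e) :
  exists Psi : {set {set T}}, toi_coalition_partition e Psi.
Proof.
have nbr := min_degree_gt0_neighbor e_deg.
have [a _] := min_degree_gt0_inhabited e_deg.
have [X|nosplit] := pickP (fun X : {set T} => ~~ toids e X && ~~ toids e (~: X)).
  by case/andP => nX nXC; exists [set X; ~: X]; apply: split_coalition_partition.
exists [set [set x] | x : T]; apply: nosplit_coalition_partition a nbr => // X.
by have /negbT := nosplit X; rewrite negb_and !negbK.
Qed.
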